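(* Let $[a,b]\subset\mathbb{R}$ be a compact interval with $a<b$ and let $V:[a,b]\to\mathbb{R}$ be a potential that is bounded from below. Let $\lambda_1$ be the smallest eigenvalue of the Schr\''odinger operator $-\frac{d^2}{dx^2}+V$ on $[a,b]$ with Dirichlet boundary conditions at the endpoints $a$ and $b$. Then $$\lambda_1 \;\geq\; \frac{1}{250}\,\min_{y>\min V}\left(\frac{1}{w_V(y)^2}+y\right).$$ Moreover, if the sublevel set $\{x\in[a,b]: V(x)\leq y^*\}$ is an interval for the value $y^*\in\mathbb{R}$ solving the minimization problem $\min_{y>\min V}\left(\frac{1}{w_V(y)^2}+y\right)$, then $$\lambda_1 \;\leq\; \pi^2\,\min_{y>\min V}\left(\frac{1}{w_V(y)^2}+y\right).$$
   Context: For $y\in\mathbb{R}$ with $y\geq\min V$, the function $w_V$ is defined by measuring the length of the sublevel sets of $V$: $$w_V(y)=|I_y|,\qquad I_y:=\{x\in[a,b]: V(x)\leq y\},$$ where $|\cdot|$ denotes Lebesgue measure (length). Here $\min V$ is the minimal value of $V$ (its infimum, if not attained), and the minimum over $y>\min V$ is understood as an infimum if it is not attained; $1/w_V(y)^2$ is read as $+\infty$ if $w_V(y)=0$. The eigenvalue $\lambda_1$ is characterized by the Rayleigh--Ritz quotient: it is the minimum of $\int_a^b \left(f'(x)^2+V(x)f(x)^2\right)dx \big/ \int_a^b f(x)^2\,dx$ over nonzero admissible functions $f$ with $f(a)=f(b)=0$.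
   Formalization: The potential V is additionally assumed measurable with min V ≥ 0; for merely bounded-below V the claim is false (e.g. V = -C constant on a long interval violates the lower bound). *)

(* Defs.v *)
From HB Require Import structures.
From mathcomp Require Import all_boot all_order all_algebra.
From mathcomp Require Import all_classical all_reals all_analysis.
Import Order.TTheory GRing.Theory Num.Theory.
Import numFieldNormedType.Exports.

Set Implicit Arguments.
Unset Strict Implicit.
Unset Printing Implicit Defensive.

Local Open Scope classical_set_scope.
Local Open Scope ring_scope.

(* A potential on [a, b] is a function V : R -> R; every definition below
   depends only on the values of V on `[a, b]. *)

Definition minV (R : realType) (a b : R) (V : R -> R) : R :=
  inf (V @` `[a, b]).

Definition sublevel (R : realType) (a b : R) (V : R -> R) (y : R) : set R :=
  [set x | x \in `[a, b] /\ V x <= y].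

Definition sublevel_length (R : realType) (a b : R) (V : R -> R) (y : R) :
  \bar R := lebesgue_measure (sublevel a b V y).

(* 1 / w_V(y)^2 + y; the extended inverse satisfies 0^-1 = +oo. *)
Definition objective (R : realType) (a b : R) (V : R -> R) (y : R) : \bar R :=
  (((sublevel_length a b V y) ^+ 2)^-1 + y%:E)%E.

Definition min_objective (R : realType) (a b : R) (V : R -> R) : \bar R :=
  ereal_inf [set objective a b V y | y in [set y | minV a b V < y]].

(* f is in H^1_0(a, b) with weak derivative f' in L^2(a, b): f is the continuous
   representative, i.e. an indefinite integral of f', and vanishes at a and b. *)
Definition H10 (R : realType) (a b : R) (f f' : R -> R) : Prop :=
  [/\ measurable_fun `[a, b] f',
      (\int[lebesgue_measure]_(x in `[a, b]) ((f' x) ^+ 2)%:E < +oo)%E,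
      forall x, x \in `[a, b] ->
        f x = f a + Rintegral lebesgue_measure `[a, x] f',
      f a = 0
    & f b = 0].

(* The numerator is +oo when V f^2 is not integrable, so such f never lower
   the infimum below: the form domain is {f in H^1_0 | V f^2 in L^1}. *)
Definition rayleigh (R : realType) (a b : R) (V f f' : R -> R) : \bar R :=
  ((\int[lebesgue_measure]_(x in `[a, b]) ((f' x) ^+ 2 + V x * (f x) ^+ 2)%:E)
   / (\int[lebesgue_measure]_(x in `[a, b]) ((f x) ^+ 2)%:E))%E.

(* Smallest Dirichlet eigenvalue of - d^2/dx^2 + V on [a, b], through the
   Rayleigh-Ritz quotient; it is +oo when the form domain is trivial. *)
Definition lambda1 (R : realType) (a b : R) (V : R -> R) : \bar R :=
  ereal_inf [set q | exists f f' : R -> R,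
    [/\ H10 a b f f',
        exists2 x, x \in `[a, b] & f x != 0
      & q = rayleigh a b V f f']].

(* Main.v *)
Require Import Defs.
From HB Require Import structures.
From mathcomp Require Import all_boot all_order all_algebra.
From mathcomp Require Import all_classical all_reals all_analysis.
From mathcomp Require Import measurable_realfun ring lra.
Import Order.TTheory GRing.Theory Num.Theory.
Import numFieldNormedType.Exports.

(* Lower bound.  Let m be the minimum, take y = m/2 and w = sqrt (2/m), so that
   the objective at y forces the sublevel set E = {V <= y} to have length at
   most w (if m/2 <= min V, the bound V >= m/2 suffices).  Cut [a, b] into pieces
   J of length l between 2w and 4w.  On such a piece E occupies at most half of J,
   and |f(x) - f(z)|^2 <= l * int_J f'^2, so the values f(z) with z outside E
   control f(x) for every x in J, whence int_J f^2 <= 32 w^2 int_J (f'^2 + V f^2).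
   If b - a < 2w, the boundary condition f(a) = 0 replaces the points z.  This
   gives the constant 1/64.
   Upper bound.  Test with half a period of the sine on the sublevel interval. *)

Set Implicit Arguments.
Unset Strict Implicit.
Unset Printing Implicit Defensive.

Local Open Scope classical_set_scope.
Local Open Scope ring_scope.

Lemma sqr_integrable (R : realType) (c d : R) (g : R -> R) :
  measurable_fun `[c, d] g ->
  (\int[lebesgue_measure]_(x in `[c, d]) ((g x) ^+ 2)%:E < +oo)%E ->
  lebesgue_measure.-integrable `[c, d] (EFin \o (fun x => g x ^+ 2)).
Proof.
move=> mg goo; apply/integrableP; split.
  by apply/measurable_EFinP; exact: measurable_funX.
by under eq_integral do rewrite /= ger0_norm ?sqr_ge0//.
Qed.

Lemma itv_integrable_cst (R : realType) (c d k : R) :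
  lebesgue_measure.-integrable `[c, d] (EFin \o (fun _ : R => k)).
Proof.
apply: continuous_compact_integrable; first exact: segment_compact.
by apply: continuous_subspaceT => x; exact: cvg_cst.
Qed.

Lemma sqr_integrable_integrable (R : realType) (c d : R) (g : R -> R) :
  measurable_fun `[c, d] g ->
  (\int[lebesgue_measure]_(x in `[c, d]) ((g x) ^+ 2)%:E < +oo)%E ->
  lebesgue_measure.-integrable `[c, d] (EFin \o g).
Proof.
move=> mg goo; have ig2 := sqr_integrable mg goo.
have i1g2 : lebesgue_measure.-integrable `[c, d]
    ((EFin \o (fun _ : R => 1%R)) \+ (EFin \o (fun x => g x ^+ 2)%R))%E.
  by apply: integrableD => //; exact: itv_integrable_cst.
apply: le_integrable i1g2 => //; first exact/measurable_EFinP.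
move=> x _ /=; rewrite lee_fin [leRHS]ger0_norm ?addr_ge0 ?sqr_ge0//.
by rewrite ler_norml; apply/andP; split; nra.
Qed.

Lemma Rintegral_sqr_le (R : realType) (c d : R) (g : R -> R) : c <= d ->
  measurable_fun `[c, d] g ->
  (\int[lebesgue_measure]_(x in `[c, d]) ((g x) ^+ 2)%:E < +oo)%E ->
  (\int[lebesgue_measure]_(x in `[c, d]) g x) ^+ 2 <=
  (d - c) * \int[lebesgue_measure]_(x in `[c, d]) (g x ^+ 2).
Proof.
rewrite le_eqVlt => /orP[/eqP <- _ _|cd mg goo].
  by rewrite set_itv1 Rintegral_set1 expr0n/= subrr mul0r.
have ig2 := sqr_integrable mg goo.
have ig := sqr_integrable_integrable mg goo.
set F := (X in X ^+ 2 <= _); set D := (X in _ * X).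
pose k := F / (d - c).
have ikg : lebesgue_measure.-integrable `[c, d] (EFin \o (fun x => - (2 * k) * g x)).
  exact: (integrableZl _ _ ig).
have : 0 <= \int[lebesgue_measure]_(x in `[c, d]) ((g x ^+ 2 + - (2 * k) * g x) + k ^+ 2).
  by apply: Rintegral_ge0 => x _; rewrite (_ : _ + _ = (g x - k) ^+ 2) ?sqr_ge0//; ring.
rewrite RintegralD//; last exact: itv_integrable_cst.
  rewrite RintegralD// RintegralZl// Rintegral_cst//= lebesgue_measure_itv/= lte_fin cd/=.
  rewrite -/F -/D /k => h.
  have dc : 0 < d - c by rewrite subr_gt0.
  have : 0 <= (D + - (2 * (F / (d - c))) * F + (F / (d - c)) ^+ 2 * (d - c)) * (d - c).
    by rewrite mulr_ge0// ltW.
  have -> : (D + - (2 * (F / (d - c))) * F + (F / (d - c)) ^+ 2 * (d - c)) * (d - c) =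
    (d - c) * D - F ^+ 2 by field; rewrite gt_eqF.
  by rewrite subr_ge0.
exact: (integrableD _ ig2 ikg).
Qed.

Lemma lebesgue_measure_cc (R : realType) (c d : R) : c <= d ->
  lebesgue_measure `[c, d] = (d - c)%:E.
Proof.
move=> cd; rewrite lebesgue_measure_itv/= lte_fin; case: ltP => // dc.
by rewrite (@le_anti _ _ c d) ?cd// subrr.
Qed.

Lemma integrable_subitv (R : realType) (a b c d : R) (h : R -> R) :
  a <= c -> d <= b ->
  lebesgue_measure.-integrable `[a, b] (EFin \o h) ->
  lebesgue_measure.-integrable `[c, d] (EFin \o h).
Proof.
move=> ac db; apply: integrableS => //.
by apply: subset_itv; rewrite bnd_simp.
Qed.

Lemma measurable_fun_subitv (R : realType) (a b c d : R) (h : R -> R) :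
  a <= c -> d <= b -> measurable_fun `[a, b] h -> measurable_fun `[c, d] h.
Proof.
move=> ac db; apply: measurable_funS => //.
by apply: subset_itv; rewrite bnd_simp.
Qed.

Section H10_theory.
Context (R : realType) (a b : R) (f f' : R -> R) (Hf : H10 a b f f').

Lemma H10_integrable : lebesgue_measure.-integrable `[a, b] (EFin \o f').
Proof. by case: Hf => mf' f'oo _ _ _; exact: sqr_integrable_integrable. Qed.

Lemma H10_sqr_integrable (c d : R) : a <= c -> d <= b ->
  lebesgue_measure.-integrable `[c, d] (EFin \o (fun x => f' x ^+ 2)).
Proof.
case: Hf => mf' f'oo _ _ _ ac db.
exact: (integrable_subitv ac db (sqr_integrable mf' f'oo)).
Qed.

Lemma H10_sub (z x : R) : a <= z -> z <= x -> x <= b ->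
  f x - f z = \int[lebesgue_measure]_(t in `[z, x]) f' t.
Proof.
case: Hf => _ _ fE _ _ az zx xb.
rewrite fE ?in_itv/= ?(le_trans az zx)// (fE z) ?in_itv/= ?az ?(le_trans zx)//.
have iax := integrable_subitv (lexx a) xb H10_integrable.
rewrite opprD addrACA subrr add0r Rintegral_itvB ?bnd_simp//.
by rewrite Rintegral_itv_obnd_cbnd//; apply: integrableS iax => //;
   apply: subset_itv; rewrite bnd_simp.
Qed.

Lemma H10_sqr_sub_le (c d x z : R) : a <= c -> d <= b ->
  x \in `[c, d] -> z \in `[c, d] ->
  (f x - f z) ^+ 2 <=
  (d - c) * \int[lebesgue_measure]_(t in `[c, d]) (f' t ^+ 2).
Proof.
move=> ac db; wlog zx : x z / z <= x => [h xcd zcd|].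
  have [/h|/ltW/h] := leP z x; first exact.
  by rewrite -(opprB (f x)) sqrrN; exact.
rewrite !in_itv/= => /andP[cx xd] /andP[cz zd].
have [az xb] : a <= z /\ x <= b by split; [exact: le_trans ac cz|exact: le_trans xd db].
case: Hf => mf' f'oo _ _ _.
rewrite (H10_sub az zx xb).
have mcd := measurable_fun_subitv ac db mf'.
have icd := H10_sqr_integrable ac db.
have izx := H10_sqr_integrable az xb.
apply: (le_trans (Rintegral_sqr_le zx _ _)).
- exact: measurable_fun_subitv az xb mf'.
- case/integrableP : izx => _.
  by under eq_integral do rewrite /= ger0_norm ?sqr_ge0//.
apply: ler_pM; rewrite ?subr_ge0 ?lerB//.
  by apply: Rintegral_ge0 => t _; exact: sqr_ge0.
apply: fine_le.
- exact: integrable_fin_num.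
- exact: integrable_fin_num.
- apply: ge0_subset_integral => //.
  + exact: (measurable_int lebesgue_measure).
  + by move=> t _; rewrite lee_fin sqr_ge0.
  + by apply: subset_itv; rewrite bnd_simp.
Qed.

Lemma H10_measurable : a <= b -> measurable_fun `[a, b] f.
Proof.
move=> ab; case: (Hf) => _ _ fE _ _.
have mP : measurable_fun `[a, b]
    (fun x => f a + parameterized_integral lebesgue_measure a x f').
  apply: measurable_funD => //.
  apply: subspace_continuous_measurable_fun => //.
  exact: (parameterized_integral_continuous ab H10_integrable).
apply: eq_measurable_fun mP => x; rewrite inE/= => xab; symmetry; exact: fE.
Qed.

End H10_theory.

Lemma ge0_integral_itv_lower (R : realType) (c d k w : R) (E : set R) (g : R -> R) :
  c <= d -> 0 <= k -> measurable E -> (lebesgue_measure E <= w%:E)%E ->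
  measurable_fun `[c, d] g -> (forall x, x \in `[c, d] -> 0 <= g x) ->
  (forall x, x \in `[c, d] -> ~ E x -> k <= g x) ->
  ((k * (d - c - w))%:E <= \int[lebesgue_measure]_(x in `[c, d]) (g x)%:E)%E.
Proof.
move=> cd k0 mE Ew mg g0 gk.
have mD : measurable (`[c, d] `\` E) by exact: measurableD.
have muD : ((d - c - w)%:E <= lebesgue_measure (`[c, d] `\` E))%E.
  rewrite EFinB leeBlDr// -(lebesgue_measure_cc cd).
  apply: (@le_trans _ _ (lebesgue_measure ((`[c, d] `\` E) `|` E))).
    apply: le_measure; rewrite ?inE//; first exact: measurableU.
    by move=> x xcd; have [Ex|nEx] := pselect (E x); [right|left].
  apply: (le_trans (measureU2 _ _ _)) => //.
  exact: leeD.
apply: (@le_trans _ _ (\int[lebesgue_measure]_(x in `[c, d] `\` E) (cst k%:E x))%E).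
  by rewrite integral_cst// EFinM lee_wpmul2l// lee_fin.
have mgE : measurable_fun `[c, d] (EFin \o g) by exact/measurable_EFinP.
apply: (@le_trans _ _ (\int[lebesgue_measure]_(x in `[c, d] `\` E) (g x)%:E)%E).
  apply: ge0_le_integral => //.
  - by apply: measurable_funS mgE => //; exact: subDsetl.
  - by move=> x [xcd nEx]; rewrite lee_fin gk.
exact: ge0_subset_integral.
Qed.

Lemma ge0_integral_itv_split (R : realType) (c e d : R) (h : R -> R) :
  c <= e -> e <= d -> measurable_fun `[c, d] h ->
  (forall x, x \in `[c, d] -> 0 <= h x) ->
  (\int[lebesgue_measure]_(x in `[c, d]) (h x)%:E =
   \int[lebesgue_measure]_(x in `[c, e]) (h x)%:E +
   \int[lebesgue_measure]_(x in `[e, d]) (h x)%:E)%E.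
Proof.
move=> ce ed mh h0.
have mhE : measurable_fun `[c, d] (EFin \o h) by exact/measurable_EFinP.
have cdE : `[c, d]%classic = `[c, e] `|` `]e, d].
  by rewrite -itv_bndbnd_setU ?bnd_simp.
rewrite -[X in (_ + X)%E]integral_itv_obnd_cbnd; last first.
  apply: measurable_funS mhE => //.
  by apply: subset_itv; rewrite bnd_simp.
rewrite cdE ge0_integral_setU -?cdE//.
apply/disj_setPS => y [/=]; rewrite !in_itv/= => /andP[_ ye] /andP[].
by rewrite ltNge ye.
Qed.

Lemma measurable_sublevel (R : realType) (a b y : R) (V : R -> R) :
  measurable_fun `[a, b] V -> measurable (sublevel a b V y).
Proof.
move=> mV; rewrite (_ : sublevel _ _ _ _ = `[a, b] `&` (V @^-1` `]-oo, y])).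
  exact: mV.
by apply/seteqP; split => x /= [xab Vx]; split => //; rewrite in_itv/= in Vx *.
Qed.

Section energy.
Context (R : realType) (a b : R) (V : R -> R) (f f' : R -> R).
Hypotheses (hab : a <= b) (mV : measurable_fun `[a, b] V).
Hypotheses (V0 : forall x, x \in `[a, b] -> 0 <= V x) (Hf : H10 a b f f').

Definition energy (c d : R) : \bar R :=
  (\int[lebesgue_measure]_(x in `[c, d]) ((f' x) ^+ 2 + V x * (f x) ^+ 2)%:E)%E.

Definition mass (c d : R) : \bar R :=
  (\int[lebesgue_measure]_(x in `[c, d]) ((f x) ^+ 2)%:E)%E.

Lemma measurable_f'2 : measurable_fun `[a, b] (fun x => f' x ^+ 2).
Proof. by case: Hf => ? _ _ _ _; exact: measurable_funX. Qed.

Lemma measurable_f2 : measurable_fun `[a, b] (fun x => f x ^+ 2).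
Proof. by apply: measurable_funX; exact: (H10_measurable Hf). Qed.

Lemma measurable_Vf2 : measurable_fun `[a, b] (fun x => V x * f x ^+ 2).
Proof. by apply: measurable_funM => //; exact: measurable_f2. Qed.

Lemma energyE (c d : R) : a <= c -> d <= b ->
  (energy c d = (\int[lebesgue_measure]_(x in `[c, d]) (f' x ^+ 2))%:E +
    \int[lebesgue_measure]_(x in `[c, d]) (V x * (f x) ^+ 2)%:E)%E.
Proof.
move=> ac db; rewrite /energy /Rintegral fineK; last first.
  by apply: integrable_fin_num => //; exact: (H10_sqr_integrable Hf ac db).
rewrite -ge0_integralD//.
- by move=> x _; rewrite lee_fin sqr_ge0.
- by apply/measurable_EFinP; exact: (measurable_fun_subitv ac db measurable_f'2).
- move=> x xcd; rewrite lee_fin mulr_ge0 ?sqr_ge0// V0//.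
  by apply: (subset_itv _ _ xcd); rewrite bnd_simp.
- by apply/measurable_EFinP; exact: (measurable_fun_subitv ac db measurable_Vf2).
Qed.

Lemma mass_le_cst (c d B : R) : a <= c -> c <= d -> d <= b ->
  (forall x, x \in `[c, d] -> f x ^+ 2 <= B) ->
  (mass c d <= (B * (d - c))%:E)%E.
Proof.
move=> ac cd db fB.
apply: (@le_trans _ _ (\int[lebesgue_measure]_(x in `[c, d]) (cst B%:E x))%E).
  apply: ge0_le_integral => //.
  - by move=> x _; rewrite lee_fin sqr_ge0.
  - by apply/measurable_EFinP; exact: (measurable_fun_subitv ac db measurable_f2).
by rewrite integral_cst//= lebesgue_measure_cc// EFinM.
Qed.

(* For z in [c, d] outside the sublevel set, V z > w^-2 and
   2 f(z)^2 >= f(x)^2 - 2 (d - c) \int f'^2. *)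
Lemma mass_le_energy_local (c d w : R) : a <= c -> d <= b -> 0 < w ->
  2 * w <= d - c -> d - c <= 4 * w ->
  (lebesgue_measure (sublevel a b V (w ^- 2)) <= w%:E)%E ->
  (mass c d <= (32 * w ^+ 2)%:E * energy c d)%E.
Proof.
move=> ac db w0 cdl cdu Ew.
have cd : c <= d by nra.
rewrite energyE//.
set D := \int[_]_(x in _) _; set N := (\int[_]_(x in _) _)%E.
have D0 : 0 <= D by apply: Rintegral_ge0 => x _; exact: sqr_ge0.
have cdab x : x \in `[c, d] -> x \in `[a, b].
  by move=> xcd; apply: (subset_itv _ _ xcd); rewrite bnd_simp.
have N0 : (0 <= N)%E.
  by apply: integral_ge0 => x xcd; rewrite lee_fin mulr_ge0 ?sqr_ge0// V0// cdab.
have w20 : 0 < 32 * w ^+ 2 by rewrite mulr_gt0 ?exprn_gt0.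
have [Noo|] := eqVneq N +oo%E; first by rewrite Noo addey// gt0_muley ?lte_fin// leey.
move: N0; rewrite /N; case E1 : (integral _ _ _) => [n||]// n0 _.
rewrite lee_fin in n0.
have mE : measurable (sublevel a b V (w ^- 2)) by exact: measurable_sublevel.
have fB x : x \in `[c, d] -> f x ^+ 2 <= 8 * w * D + 2 * n * w.
  move=> xcd; have [h|h] := leP (f x ^+ 2) (8 * w * D).
    by rewrite (le_trans h)// lerDl; nra.
  pose k := w ^- 2 * ((f x ^+ 2 - 8 * w * D) / 2).
  have wi0 : 0 < w ^- 2 by rewrite invr_gt0 exprn_gt0.
  have k0 : 0 <= k by rewrite mulr_ge0 ?ltW// divr_gt0// subr_gt0.
  have := ge0_integral_itv_lower cd k0 mE Ew
    (measurable_fun_subitv ac db measurable_Vf2) _ _.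
  rewrite E1 lee_fin => kn.
  have {}kn : k * (d - c - w) <= n.
    apply: kn => z zcd; first by rewrite mulr_ge0 ?sqr_ge0// V0// cdab.
    move=> nEz; have Vz : w ^- 2 <= V z.
      rewrite leNgt; apply/negP => Vz; apply: nEz; split; first exact: cdab.
      exact: ltW.
    rewrite /k ler_pM//; first exact: ltW.
      by rewrite ltW// divr_gt0// subr_gt0.
    have := H10_sqr_sub_le Hf ac db xcd zcd.
    rewrite -/D => xz; rewrite ler_pdivrMr//.
    have : (d - c) * D <= 4 * w * D by rewrite ler_wpM2r.
    have := sqr_ge0 (f x - 2 * f z); nra.
  have : k * w <= n by apply: le_trans kn; rewrite ler_wpM2l//; lra.
  rewrite /k => /(ler_wpM2r (ltW w0)).
  have -> : w ^- 2 * ((f x ^+ 2 - 8 * w * D) / 2) * w * w = (f x ^+ 2 - 8 * w * D) / 2.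
    by field; rewrite gt_eqF.
  nra.
apply: (le_trans (mass_le_cst ac cd db fB)).
rewrite -EFinD -EFinM lee_fin.
have B0 : 0 <= 8 * w * D + 2 * n * w by rewrite addr_ge0// !mulr_ge0// ltW.
apply: (@le_trans _ _ ((8 * w * D + 2 * n * w) * (4 * w))).
  by rewrite ler_wpM2l.
have := mulr_ge0 (sqr_ge0 w) n0; nra.
Qed.

Lemma energy_ge0 (c d : R) : a <= c -> d <= b -> (0 <= energy c d)%E.
Proof.
move=> ac db; apply: integral_ge0 => x xcd.
rewrite lee_fin addr_ge0 ?sqr_ge0// mulr_ge0 ?sqr_ge0// V0//.
by apply: (subset_itv _ _ xcd); rewrite bnd_simp.
Qed.

Lemma mass_split (c e d : R) : a <= c -> c <= e -> e <= d -> d <= b ->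
  mass c d = (mass c e + mass e d)%E.
Proof.
move=> ac ce ed db; apply: ge0_integral_itv_split => //.
  exact: (measurable_fun_subitv ac db measurable_f2).
by move=> x _; exact: sqr_ge0.
Qed.

Lemma energy_split (c e d : R) : a <= c -> c <= e -> e <= d -> d <= b ->
  energy c d = (energy c e + energy e d)%E.
Proof.
move=> ac ce ed db; apply: ge0_integral_itv_split => //.
  apply: measurable_funD.
    exact: (measurable_fun_subitv ac db measurable_f'2).
  exact: (measurable_fun_subitv ac db measurable_Vf2).
move=> x xcd; rewrite addr_ge0 ?sqr_ge0// mulr_ge0 ?sqr_ge0// V0//.
by apply: (subset_itv _ _ xcd); rewrite bnd_simp.
Qed.

Lemma mass_le_energy_long (n : nat) (c d w : R) : a <= c -> d <= b -> 0 < w ->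
  2 * w <= d - c -> d - c <= n%:R * (2 * w) ->
  (lebesgue_measure (sublevel a b V (w ^- 2)) <= w%:E)%E ->
  (mass c d <= (32 * w ^+ 2)%:E * energy c d)%E.
Proof.
move=> ac db w0 + + Ew; elim: n c ac => [|n IHn] c ac cdl cdu.
  by exfalso; move: cdu; rewrite mul0r; lra.
have [?|long] := leP (d - c) (4 * w); first exact: mass_le_energy_local.
have ce : c <= c + 2 * w by rewrite lerDl mulr_ge0// ltW.
have ed : c + 2 * w <= d by lra.
rewrite (mass_split ac ce ed db) (energy_split ac ce ed db).
have aew : a <= c + 2 * w by rewrite (le_trans ac).
rewrite ge0_muleDr ?energy_ge0//; last exact: le_trans db.
apply: leeD.
  apply: mass_le_energy_local => //; [exact: le_trans db|lra|lra].
apply: IHn => //; first lra.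
by move: cdu; rewrite -natr1; lra.
Qed.

Lemma sqr_H10_le (x : R) : x \in `[a, b] ->
  f x ^+ 2 <= (b - a) * \int[lebesgue_measure]_(t in `[a, b]) (f' t ^+ 2).
Proof.
move=> xab; have aab : a \in `[a, b] by rewrite in_itv/= lexx.
have := H10_sqr_sub_le Hf (lexx a) (lexx b) xab aab.
by case: Hf => _ _ _ -> _; rewrite subr0.
Qed.

Lemma mass_le_dirichlet :
  (mass a b <= ((b - a) ^+ 2 *
    \int[lebesgue_measure]_(t in `[a, b]) (f' t ^+ 2))%:E)%E.
Proof.
apply: (le_trans (mass_le_cst (lexx a) hab (lexx b) sqr_H10_le)).
by rewrite lee_fin le_eqVlt; apply/orP; left; apply/eqP; ring.
Qed.

Lemma dirichlet_le_energy :
  ((\int[lebesgue_measure]_(t in `[a, b]) (f' t ^+ 2))%:E <= energy a b)%E.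
Proof.
rewrite energyE// leeDl//; apply: integral_ge0 => x xab.
by rewrite lee_fin mulr_ge0 ?sqr_ge0// V0.
Qed.

Lemma mass_le_energy (w : R) : 0 < w ->
  (lebesgue_measure (sublevel a b V (w ^- 2)) <= w%:E)%E ->
  (mass a b <= (32 * w ^+ 2)%:E * energy a b)%E.
Proof.
move=> w0 Ew; have [long|short] := leP (2 * w) (b - a).
  have [n hn] : exists n : nat, b - a <= n%:R * (2 * w).
    exists (Num.bound ((b - a) / (2 * w))).
    have w20 : 0 < 2 * w by rewrite mulr_gt0.
    rewrite -ler_pdivrMr// ltW// archi_boundP// divr_ge0 ?subr_ge0// ltW//.
  exact: (mass_le_energy_long (n := n)).
apply: (le_trans mass_le_dirichlet).
apply: (@le_trans _ _ ((32 * w ^+ 2)%:E *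
  (\int[lebesgue_measure]_(t in `[a, b]) (f' t ^+ 2))%:E)%E).
  rewrite -EFinM lee_fin ler_wpM2r//; first by apply: Rintegral_ge0 => t _; exact: sqr_ge0.
  have ba : 0 <= b - a by rewrite subr_ge0.
  nra.
rewrite lee_wpmul2l ?dirichlet_le_energy// lee_fin mulr_ge0// sqr_ge0//.
Qed.

Lemma mass_le_energy_pointwise (k : R) : 0 <= k ->
  (forall x, x \in `[a, b] -> k <= V x) -> (k%:E * mass a b <= energy a b)%E.
Proof.
move=> k0 kV; rewrite /mass -ge0_integralZl_EFin//; last 2 first.
  by move=> x _; rewrite lee_fin sqr_ge0.
  by apply/measurable_EFinP; exact: measurable_f2.
apply: ge0_le_integral => //.
- by move=> x _; rewrite -EFinM lee_fin mulr_ge0// sqr_ge0.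
- apply/measurable_EFinP; apply: measurable_funM => //; exact: measurable_f2.
- apply/measurable_EFinP; apply: measurable_funD; first exact: measurable_f'2.
  exact: measurable_Vf2.
- move=> x xab; rewrite -EFinM lee_fin.
  have := ler_wpM2r (sqr_ge0 (f x)) (kV _ xab); have := sqr_ge0 (f' x); lra.
Qed.

Lemma rayleigh_ge0 : (0 <= rayleigh a b V f f')%E.
Proof.
apply: mule_ge0; first exact: energy_ge0.
by rewrite inve_ge0; apply: integral_ge0 => x _; rewrite lee_fin sqr_ge0.
Qed.

(* When the mass vanishes the quotient is [+oo], as then the energy is positive. *)
Lemma rayleigh_ge (k : R) : (exists2 x, x \in `[a, b] & f x != 0) ->
  (k%:E * mass a b <= energy a b)%E -> (k%:E <= rayleigh a b V f f')%E.
Proof.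
move=> [x xab fx0]; rewrite /rayleigh -/(energy a b) -/(mass a b).
have m0 : (0 <= mass a b)%E by apply: integral_ge0 => t _; rewrite lee_fin sqr_ge0.
have := mass_le_dirichlet; move: m0; case: (mass a b) => [m| |]//.
rewrite lee_fin le_eqVlt => /orP[/eqP<- _ _|m0 _ kE].
  rewrite inve0 gt0_muley ?leey//; apply: lt_le_trans dirichlet_le_energy.
  rewrite lte_fin lt_neqAle Rintegral_ge0 ?andbT//; last by move=> t _; exact: sqr_ge0.
  apply/eqP => D0; have := sqr_H10_le xab; rewrite -D0 mulr0.
  by rewrite leNgt exprn_even_gt0//= fx0.
by rewrite inver gt_eqF// lee_pdivlMr.
Qed.

End energy.

Lemma minV_le (R : realType) (a b : R) (V : R -> R) (x : R) :
  has_lbound (V @` `[a, b]) -> x \in `[a, b] -> minV a b V <= V x.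
Proof. by move=> lb xab; apply: ge_inf => //; exists x. Qed.

Lemma le_lambda1 (R : realType) (a b : R) (V : R -> R) (K : R) : a < b ->
  measurable_fun `[a, b] V -> has_lbound (V @` `[a, b]) -> 0 <= minV a b V ->
  (forall y, minV a b V < y -> (K%:E <= objective a b V y)%E) ->
  ((250^-1 * K)%:E <= lambda1 a b V)%E.
Proof.
move=> ab mV lbV minV0 KV; apply: le_ereal_inf_tmp => _ [f [f' [Hf fn0 ->]]].
have V0 x : x \in `[a, b] -> 0 <= V x.
  by move=> xab; rewrite (le_trans minV0)// minV_le.
have [K0|K0] := leP K 0.
  apply: (@le_trans _ _ 0%E); last exact: rayleigh_ge0.
  by rewrite lee_fin mulr_ge0_le0.
have abW := ltW ab.
have [KV2|KV2] := leP (K / 2) (minV a b V).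
  apply: rayleigh_ge => //.
  apply: (mass_le_energy_pointwise abW mV Hf); first by rewrite mulr_ge0// ltW.
  by move=> x xab; apply: le_trans (minV_le lbV xab); lra.
pose w := Num.sqrt (2 / K).
have w2 : w ^+ 2 = 2 / K by rewrite sqr_sqrtr// divr_ge0// ltW.
have w0 : 0 < w by rewrite sqrtr_gt0 divr_gt0.
have wK : w ^- 2 = K / 2 by rewrite w2 invf_div.
apply: rayleigh_ge => //.
have Ew : (lebesgue_measure (sublevel a b V (w ^- 2)) <= w%:E)%E.
  rewrite wK; have := KV _ KV2; rewrite /objective /sublevel_length.
  have : (0 <= lebesgue_measure (sublevel a b V (K / 2)))%E by exact: measure_ge0.
  have : (lebesgue_measure (sublevel a b V (K / 2)) < +oo)%E.
    apply: (@le_lt_trans _ _ (lebesgue_measure `[a, b])); last first.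
      by rewrite lebesgue_measure_cc// ltry.
    apply: le_measure; rewrite ?inE//; last by move=> x [].
    exact: measurable_sublevel.
  case: (lebesgue_measure _) => [r| |]// _; rewrite !lee_fin => r0.
  have [->|rn0] := eqVneq r 0; first by move=> _; exact: ltW.
  have {rn0}r0 : 0 < r by rewrite lt_neqAle eq_sym rn0.
  rewrite -EFin_expe inver expf_eq0/= gt_eqF//= -EFinD lee_fin => Kr.
  have r2 : 0 < r ^+ 2 by rewrite exprn_gt0.
  rewrite -(@ler_pXn2r _ 2) ?nnegrE ?(ltW r0) ?(ltW w0)// w2.
  have : K / 2 <= (r ^+ 2)^-1 by lra.
  rewrite -[X in _ <= X -> _]div1r ler_pdivlMr// => h.
  by rewrite ler_pdivlMr//; lra.
have := mass_le_energy abW mV V0 Hf w0 Ew; rewrite w2 => mE.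
have K250 : 0 <= 250^-1 * K by rewrite mulr_ge0// ltW.
apply: (le_trans (lee_wpmul2l _ mE)); first by rewrite lee_fin.
rewrite muleA -EFinM -[leRHS]mul1e; apply: lee_wpmul2r.
  exact: (energy_ge0 _ _ V0).
rewrite lee_fin.
have -> : 250^-1 * K * (32 * (2 / K)) = 64 / 250 by field; rewrite gt_eqF.
lra.
Qed.

Lemma integral_is_derive (R : realType) (c d : R) (F h : R -> R) : c <= d ->
  (forall x : R, is_derive x 1 F (h x)) -> continuous h ->
  (\int[lebesgue_measure]_(x in `[c, d]) (h x)%:E = (F d - F c)%:E)%E.
Proof.
rewrite le_eqVlt => /orP[/eqP <- _ _|cd dF ch].
  by rewrite set_itv1 integral_set1 subrr.
have cF : continuous F.
  by move=> x; apply/differentiable_continuous/derivable1_diffP; exact: ex_derive.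
rewrite (@continuous_FTC2 _ h F)//.
- exact: continuous_subspaceT.
- split; first by move=> x _; exact: ex_derive.
  + by apply: cvg_at_right_filter; exact: cF.
  + by apply: cvg_at_left_filter; exact: cF.
- by move=> x _; rewrite derive1E derive_val.
Qed.

Section sine_bump.
Context (R : realType) (c d : R).
Hypothesis cd : c < d.

Let k : R := pi / (d - c).
Let phase (x : R) : R := k * (x - c).
Let s (x : R) : R := sin (phase x).
Let s' (x : R) : R := k * cos (phase x).

Let k_gt0 : 0 < k.
Proof. by rewrite divr_gt0 ?pi_gt0 ?subr_gt0. Qed.

Let phase_c : phase c = 0.
Proof. by rewrite /phase subrr mulr0. Qed.

Let phase_d : phase d = pi.
Proof. by rewrite /phase divfK// subr_eq0 gt_eqF. Qed.

Let is_derive_phase (x : R) : is_derive x 1 phase k.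
Proof.
have := @is_deriveD R R R (k \*: id) (cst (- (k * c))) x 1 _ _
  (is_deriveZ k (is_derive_id _ _)) (is_derive_cst _ _ _).
rewrite addr0 [_ *: _]mulr1; congr (is_derive _ _ _ _).
by apply/funext => y; rewrite /phase /= mulrBr.
Qed.

Let is_derive_s (x : R) : is_derive x 1 s (s' x).
Proof.
by rewrite /s' mulrC; apply: (is_derive1_comp (is_derive_sin _) (is_derive_phase x)).
Qed.

Let is_derive_cosp (x : R) : is_derive x 1 (cos \o phase) (- (k * s x)).
Proof.
by rewrite mulrC -mulNr; apply: (is_derive1_comp (is_derive_cos _) (is_derive_phase x)).
Qed.

Let derive_continuous (F h : R -> R) :
  (forall x : R, is_derive x 1 F (h x)) -> continuous F.
Proof.
by move=> dF x; apply/differentiable_continuous/derivable1_diffP; exact: ex_derive.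
Qed.

Let continuous_s : continuous s.
Proof. exact: derive_continuous is_derive_s. Qed.

Let continuous_s' : continuous s'.
Proof.
move=> x; apply: cvgM; first exact: cvg_cst.
exact: (derive_continuous is_derive_cosp).
Qed.

Let is_derive_scos (x : R) :
  is_derive x 1 (s * (cos \o phase)) (k * (1 - 2 * s x ^+ 2)).
Proof.
apply: is_derive_eq (is_deriveM (is_derive_s x) (is_derive_cosp x)) _.
rewrite /s' /= /GRing.scale/=.
have := cos2Dsin2 (phase x); rewrite -/(s x) => /(canRL (addrK _)) e.
by rewrite mulrCA -expr2 e; ring.
Qed.

Let integral_affine_sqr (p q : R) :
  (\int[lebesgue_measure]_(x in `[c, d]) (p + q * s x ^+ 2)%:E =
   ((p + q / 2) * (d - c))%:E)%E.
Proof.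
pose F : R -> R := ((p + q / 2) \*: id) - ((q / (2 * k)) \*: (s * (cos \o phase))).
have dF (x : R) : is_derive x 1 F (p + q * s x ^+ 2).
  apply: is_derive_eq (is_deriveB (is_deriveZ _ (is_derive_id _ _))
    (is_deriveZ _ (is_derive_scos x))) _.
  by rewrite /GRing.scale/=; field; rewrite gt_eqF.
rewrite (integral_is_derive (ltW cd) dF); last first.
  move=> x; apply: cvgD; first exact: cvg_cst.
  apply: cvgM; first exact: cvg_cst.
  by apply: cvgM; exact: continuous_s.
congr EFin; rewrite /F /= /s /= !fctE/= phase_c phase_d sinpi sin0.
by rewrite !mul0r !scaler0 /GRing.scale/=; ring.
Qed.

Let f : R -> R := s \_ `[c, d].
Let f' : R -> R := s' \_ `[c, d].

Let cutE (h : R -> R) (x : R) :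
  (h \_ `[c, d]) x = if x \in `[c, d] then h x else 0.
Proof. by rewrite patchE mem_setE. Qed.

Let f_eq0 (x : R) : ~~ (c < x < d) -> f x = 0.
Proof.
rewrite /f cutE; case: ifPn => //; rewrite in_itv/= => /andP[].
rewrite le_eqVlt => /orP[/eqP<- _ _|->]; first by rewrite /s phase_c sin0.
by rewrite le_eqVlt => /orP[/eqP-> _|->//]; rewrite /s phase_d sinpi.
Qed.

Context (a b : R).
Hypotheses (ac : a <= c) (db : d <= b).

Let integral_cut (h : R -> R) :
  (\int[lebesgue_measure]_(x in `[a, b]) ((h \_ `[c, d]) x)%:E =
   \int[lebesgue_measure]_(x in `[c, d]) (h x)%:E)%E.
Proof.
have cdE : `[c, d]%classic = `[a, b] `&` `[c, d].
  by rewrite setIC setIidl//; apply: subset_itv; rewrite bnd_simp.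
rewrite [in RHS]cdE integral_mkcondr; apply: eq_integral => x _.
by rewrite !patchE; case: ifP.
Qed.

Let measurable_cut (h : R -> R) : continuous h ->
  measurable_fun `[a, b] (h \_ `[c, d]).
Proof.
move=> ch; apply/measurable_restrict => //.
by apply: measurable_funTS; exact: continuous_measurable_fun.
Qed.

Let f'_sqr (x : R) : f' x ^+ 2 = ((fun x => k ^+ 2 + (- k ^+ 2) * s x ^+ 2) \_ `[c, d]) x.
Proof.
rewrite /f' !cutE; case: ifP => _; last by rewrite expr0n.
have := cos2Dsin2 (phase x); rewrite /s' -/(s x) exprMn => /(canRL (addrK _)) ->.
by ring.
Qed.

Let f_sqr (x : R) : f x ^+ 2 = ((fun x => 0 + 1 * s x ^+ 2) \_ `[c, d]) x.
Proof.
by rewrite /f !cutE; case: ifP => _; rewrite ?expr0n// add0r mul1r.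
Qed.

Let Rintegral_s' (x : R) : c <= x ->
  \int[lebesgue_measure]_(t in `[c, x]) s' t = s x.
Proof.
move=> cx; rewrite /Rintegral (integral_is_derive cx is_derive_s)//=.
by rewrite [s c]/s phase_c sin0 subr0.
Qed.

Let H10_bump : H10 a b f f'.
Proof.
have fa : f a = 0 by apply: f_eq0; rewrite negb_and -leNgt ac.
split => //.
- exact: measurable_cut.
- under eq_integral do rewrite f'_sqr.
  by rewrite integral_cut integral_affine_sqr ltry.
- move=> x; rewrite in_itv/= => /andP[ax xb]; rewrite fa add0r.
  rewrite /f' -Rintegral_mkcondr.
  have [xc|cx] := ltP x c.
    rewrite f_eq0; last by rewrite negb_and -leNgt (ltW xc).
    rewrite (_ : _ `&` _ = set0) ?Rintegral_set0//.
    apply/seteqP; split => y //= []; rewrite !in_itv/= => /andP[_ yx] /andP[cy _].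
    by move: (le_lt_trans (le_trans cy yx) xc); rewrite ltxx.
  have [xd|dx] := leP x d.
    rewrite (_ : _ `&` _ = `[c, x]%classic); last first.
      apply/seteqP; split => y /=; rewrite !in_itv/=.
        by move=> [/andP[_ ->] /andP[-> _]].
      by move=> /andP[cy yx]; rewrite (le_trans ac cy) yx cy (le_trans yx xd).
    by rewrite Rintegral_s'// /f cutE in_itv/= cx xd.
  rewrite f_eq0; last by rewrite negb_and -!leNgt (ltW dx) orbT.
  rewrite (_ : _ `&` _ = `[c, d]%classic); last first.
    apply/seteqP; split => y /=; rewrite !in_itv/=; first by case.
    by move=> /andP[cy yd]; rewrite (le_trans ac cy) cy yd (le_trans yd)// ltW.
  by rewrite Rintegral_s' ?ltW// /s phase_d sinpi.
- by apply: f_eq0; rewrite negb_and -!leNgt db orbT.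
Qed.

Lemma lambda1_le_sine_bump (V : R -> R) (y : R) :
  measurable_fun `[a, b] V ->
  (forall x, x \in `[a, b] -> 0 <= V x) ->
  (forall x, c < x < d -> V x <= y) ->
  (lambda1 a b V <= ((pi / (d - c)) ^+ 2 + y)%:E)%E.
Proof.
move=> mV V0 Vy; apply: ge_ereal_inf; exists (rayleigh a b V f f').
  exists f, f'; split => //.
  have cm : c < (c + d) / 2 < d by rewrite midf_lt// midf_lt.
  exists ((c + d) / 2).
    rewrite in_itv/=; case/andP: cm => cm md.
    by rewrite (le_trans ac (ltW cm)) (le_trans (ltW md) db).
  rewrite /f cutE in_itv/=; case/andP: (cm) => cm1 cm2; rewrite (ltW cm1) (ltW cm2)/=.
  rewrite /s gt_eqF// sin_gt0_pi//; apply/andP; split.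
    by rewrite mulr_gt0// subr_gt0.
  by rewrite -phase_d /phase ltr_pM2l// ltrD2r.
rewrite /rayleigh.
have -> : (\int[lebesgue_measure]_(x in `[a, b]) (f x ^+ 2)%:E = ((d - c) / 2)%:E)%E.
  under eq_integral do rewrite f_sqr.
  by rewrite integral_cut integral_affine_sqr; congr EFin; field.
have dc0 : 0 < (d - c) / 2 by rewrite divr_gt0// subr_gt0.
rewrite inver gt_eqF// lee_pdivrMr//.
have mf : measurable_fun `[a, b] f by exact: measurable_cut.
have mf' : measurable_fun `[a, b] f' by exact: measurable_cut.
apply: (@le_trans _ _ (\int[lebesgue_measure]_(x in `[a, b])
    (((fun x => k ^+ 2 + (y - k ^+ 2) * s x ^+ 2) \_ `[c, d]) x)%:E)%E); last first.
  rewrite integral_cut integral_affine_sqr -EFinM lee_fin -/k.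
  by rewrite le_eqVlt; apply/orP; left; apply/eqP; field.
apply: ge0_le_integral => //.
- by move=> x xab; rewrite lee_fin addr_ge0 ?sqr_ge0// mulr_ge0 ?sqr_ge0 ?V0.
- apply/measurable_EFinP; apply: measurable_funD; first exact: measurable_funX.
  by apply: measurable_funM => //; exact: measurable_funX.
- apply/measurable_EFinP; apply: measurable_cut => x.
  apply: cvgD; first exact: cvg_cst.
  apply: cvgM; first exact: cvg_cst.
  by apply: cvgM; exact: continuous_s.
- move=> x xab; rewrite lee_fin f'_sqr.
  apply: (@le_trans _ _ (f' x ^+ 2 + y * f x ^+ 2)); last first.
    rewrite f'_sqr f_sqr !cutE; case: ifP => _; lra.
  rewrite f'_sqr lerD2l; have [xcd|xcd] := boolP (c < x < d).
    by rewrite ler_wpM2r ?sqr_ge0// Vy.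
  by rewrite f_eq0// expr0n/= !mulr0.
Qed.

End sine_bump.

Lemma is_interval_inf_sup (R : realType) (I : set R) (x : R) : is_interval I ->
  I !=set0 -> inf I < x < sup I -> I x.
Proof.
move=> iI I0 /andP[/(inf_lt I0)[u Iu ux] /(sup_gt I0)[v Iv xv]].
by apply: (iI u v) => //; rewrite !ltW.
Qed.

Lemma min_objective_ge0 (R : realType) (a b : R) (V : R -> R) :
  0 <= minV a b V -> (0 <= min_objective a b V)%E.
Proof.
move=> minV0; apply: le_ereal_inf_tmp => _ [y /= Vy <-].
apply: adde_ge0; last by rewrite lee_fin (le_trans minV0)// ltW.
by rewrite inve_ge0 expe_ge0// measure_ge0.
Qed.

Lemma lambda1_le (R : realType) (a b : R) (V : R -> R) (y : R) :
  measurable_fun `[a, b] V -> (forall x, x \in `[a, b] -> 0 <= V x) -> 0 <= y ->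
  is_interval (sublevel a b V y) ->
  (lambda1 a b V <= (pi ^+ 2 : R)%:E * objective a b V y)%E.
Proof.
move=> mV V0 y0 iI; rewrite /objective /sublevel_length.
set I := sublevel a b V y.
have pi20 : 0 < (pi : R) ^+ 2 by rewrite exprn_gt0// pi_gt0.
have [->|muI0] := eqVneq (lebesgue_measure I) 0%E.
  by rewrite expe2 mule0 inve0 addye// gt0_muley ?lte_fin// leey.
have I0 : I !=set0.
  by apply/set0P/eqP => I0; move: muI0; rewrite I0 measure0 eqxx.
have subI x : I x -> a <= x <= b by case; rewrite in_itv.
have lbI : has_lbound I by exists a => x /subI/andP[].
have ubI : has_ubound I by exists b => x /subI/andP[].
have ac : a <= inf I by apply: lb_le_inf => // x /subI/andP[].
have db : sup I <= b by apply: ge_sup => // x /subI/andP[].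
have Icd : I `<=` `[inf I, sup I].
  by move=> x Ix; rewrite /= in_itv/= ge_inf// ub_le_sup.
have muI : (lebesgue_measure I <= lebesgue_measure `[inf I, sup I])%E.
  by apply: le_measure; rewrite ?inE//; exact: measurable_sublevel.
have cd : inf I < sup I.
  rewrite ltNge; apply/negP => dc; move: muI muI0.
  have [x Ix] := I0; have := Icd _ Ix; rewrite /= in_itv/= => /andP[cx xd].
  rewrite lebesgue_measure_cc ?(le_trans cx)//.
  rewrite (@le_anti _ _ (inf I) (sup I)) ?dc ?(le_trans cx)// subrr => muI.
  by rewrite eq_le muI measure_ge0.
have IV x : inf I < x < sup I -> V x <= y.
  by move=> /(is_interval_inf_sup iI I0) [].
apply: (le_trans (lambda1_le_sine_bump cd ac db mV V0 IV)).
have : (0 <= lebesgue_measure I)%E by exact: measure_ge0.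
move: muI muI0.
rewrite (lebesgue_measure_cc (ltW cd)).
case: (lebesgue_measure I) => [w| |]//; rewrite !lee_fin => wcd wn0 w0.
have {wn0}w0 : 0 < w by rewrite lt_neqAle eq_sym w0 andbT.
rewrite -EFin_expe inver expf_eq0/= gt_eqF//= -EFinD -EFinM lee_fin mulrDr.
rewrite lerD//; last first.
  by rewrite ler_peMl// exprn_ege1// (le_trans _ (pi_ge2 R))// ler1n.
rewrite expr_div_n ler_pM2l// lef_pV2 ?posrE ?exprn_gt0// ?subr_gt0//.
by rewrite ler_pXn2r// nnegrE ltW// subr_gt0.
Qed.

Unset Implicit Arguments.

Theorem theorem1 (R : realType) (a b : R) (V : R -> R)
  (hab : a < b)
  (hmeas : measurable_fun `[a, b] V)
  (hbound : has_lbound (V @` `[a, b]))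
  (hmin : 0 <= minV a b V) :
  ((250^-1 : R)%:E * min_objective a b V <= lambda1 a b V)%E
  /\
  (forall ystar : R,
     minV a b V < ystar ->
     objective a b V ystar = min_objective a b V ->
     is_interval (sublevel a b V ystar) ->
     (lambda1 a b V <= (pi ^+ 2 : R)%:E * min_objective a b V)%E).
Proof.
have V0 x : x \in `[a, b] -> 0 <= V x.
  by move=> xab; rewrite (le_trans hmin)// minV_le.
split; last first.
  move=> y Vy <- iI; apply: lambda1_le => //.
  by rewrite (le_trans hmin)// ltW.
have lam (K : R) : (K%:E <= min_objective a b V)%E ->
    ((250^-1 * K)%:E <= lambda1 a b V)%E.
  move=> KM; apply: le_lambda1 => // y Vy; apply: (le_trans KM).
  by apply: ereal_inf_lbound; exists y.
have := min_objective_ge0 hmin.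
case E : (min_objective a b V) => [r| |]// _.
  by rewrite -EFinM; apply: lam; rewrite E.
rewrite gt0_muley ?lte_fin// leye_eq; apply/eqP/eq_infty => r.
have := lam (250 * r); rewrite E leey mulKf//; exact.
Qed.
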